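(* Let $(N,v)$ be a cooperative game and let $\mathcal{Q} \subseteq \mathcal{N}$ be an independent collection of coalitions, with Gram matrix $G$. Then for all $x \in X(v)$, $$\pi_{A_\mathcal{Q}}(x) = x + \sum_{S \in \mathcal{Q}} \gamma^{\mathcal{Q}}_S(x)\, \eta^S, \qquad \text{where } \gamma^{\mathcal{Q}}_S(x) = \left[ G^{-1} e_{\mathcal{Q}}(x) \right]_S .$$
   Context: $N$ is a finite nonempty set of players, and $\mathcal{N}$ is the set of nonempty subsets of $N$, called coalitions. A game is a pair $(N,v)$ with $v : 2^N \to \mathbb{R}$ and $v(\emptyset)=0$. For $x \in \mathbb{R}^N$ and $S \subseteq N$, $x(S) = \sum_{i\in S} x_i$. $\mathbb{R}^N$ carries the usual scalar product $\langle\cdot,\cdot\rangle$ and Euclidean norm. $X(v) = \{x \in \mathbb{R}^N \mid x(N) = v(N)\}$ is the set of preimputations. For $S \subseteq N$, $\mathbf{1}^S \in \mathbb{R}^N$ is the indicator vector of $S$ and $\eta^S = \mathbf{1}^S - \frac{|S|}{|N|}\mathbf{1}^N$. A collection $\mathcal{Q} \subseteq \mathcal{N}$ is independent if the vectors $\{\eta^S \mid S \in \mathcal{Q}\}$ are linearly independent. The Gram matrix $G$ of $\mathcal{Q}$ is the $\mathcal{Q}\times\mathcal{Q}$ matrix with entries $\langle \eta^S, \eta^T\rangle$, $S,T \in \mathcal{Q}$; it is invertible when $\mathcal{Q}$ is independent. $A_\mathcal{Q} = \{x \in X(v) \mid x(S) = v(S) \text{ for all } S \in \mathcal{Q}\}$.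 The excess of $S$ at $x$ is $e_S(x) = v(S) - x(S)$, and $e_\mathcal{Q}(x) \in \mathbb{R}^\mathcal{Q}$ is the vector with coordinates $[e_\mathcal{Q}(x)]_S = e_S(x)$. For a nonempty closed convex set $K \subseteq \mathbb{R}^N$, $\pi_K(x)$ denotes the unique point of $K$ closest to $x$ in Euclidean norm. When $\mathcal{Q}$ is independent, $A_\mathcal{Q}$ is nonempty. *)

(* Defs.v *)
From HB Require Import structures.
From mathcomp Require Import all_boot all_order all_algebra.
From mathcomp Require Import boolp classical_sets reals.

Set Implicit Arguments.
Unset Strict Implicit.
Unset Printing Implicit Defensive.

Import Order.TTheory GRing.Theory Num.Theory.
Local Open Scope ring_scope.

(* The codomain [R^o] makes [vec R N] a finite-dimensional vector space over
   [R], so that the library predicate [free] applies. *)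
Notation vec R N := {ffun N -> R^o}.

Section Defs.
Variables (R : realType) (N : finType).
Implicit Types (v : {set N} -> R) (x y p : vec R N) (S T : {set N}).
Implicit Types (Q : {set {set N}}) (K : set (vec R N)).

Definition dot x y : R := \sum_(i : N) x i * y i.

Definition enorm x : R := Num.sqrt (dot x x).

Definition payoff x S : R := \sum_(i in S) x i.

Definition preimputations v : set (vec R N) :=
  [set x | payoff x [set: N]%SET = v [set: N]%SET]%classic.

Definition indicator S : vec R N := [ffun i => (i \in S)%:R].

Definition eta S : vec R N :=
  indicator S - (#|S|%:R / #|N|%:R : R) *: indicator [set: N]%SET.

Definition independent Q : Prop := free [seq eta T | T <- enum Q].

(* Rows and columns indexed by [Q] are numbered along the bijection
   [enum_val : 'I_#|Q| -> Q]. *)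
Definition gram Q : 'M[R]_#|Q| :=
  \matrix_(i, j) dot (eta (enum_val i)) (eta (enum_val j)).

Definition affine v Q : set (vec R N) :=
  [set x | preimputations v x /\ forall S, S \in Q -> payoff x S = v S]%classic.

Definition excess v S x : R := v S - payoff x S.

Definition excess_vec v Q x : 'cV[R]_#|Q| :=
  \col_i excess v (enum_val i) x.

Definition gamma v Q x (i : 'I_#|Q|) : R :=
  (invmx (gram Q) *m excess_vec v Q x) i ord0.

(* The strict inequality says that [p] is the unique point of [K] closest to
   [x]. *)
Definition closest K x p : Prop :=
  K p /\ forall y, K y -> y != p -> enorm (x - p) < enorm (x - y).

(* The default value [0] is used only if there is no unique closest point, which
   does not happen when [K] is nonempty, closed and convex. *)
Definition proj K x : vec R N := xget 0 [set p | closest K x p]%classic.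

End Defs.

(* Main.v *)
Require Import Defs.
From mathcomp Require Import all_boot all_order all_algebra.
From mathcomp Require Import boolp classical_sets reals.

Set Implicit Arguments.
Unset Strict Implicit.
Unset Printing Implicit Defensive.

Import Order.TTheory GRing.Theory Num.Theory.
Local Open Scope ring_scope.

(** Write [p] for the claimed projection. Since [eta S] is the orthogonal
    projection of the indicator of [S] onto the vectors whose coordinates sum to
    zero, pairing with the [eta S] captures every coalition constraint as soon
    as the total payoff is fixed ([dot_eta], [payoff_eta]).

    Feasibility: moving along the [eta S] preserves [x(N)], and it changes the
    payoff of the [i]-th coalition of [Q] by the [i]-th coordinate of
    [G *m gamma], which is the excess of that coalition at [x] because [G] is
    invertible ([gram_unitmx]). Hence [p] lies in [affine v Q].

    Optimality: the difference of two points of [affine v Q] is orthogonal to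
    every [eta S] with [S] in [Q], hence to [x - p], which is a combination of
    them. The Pythagorean theorem makes [p] the strictly closest point
    ([closest_orthogonal]). *)

Section ScalarProduct.
Variables (R : realType) (N : finType).
Implicit Types (x y z p : vec R N) (K : set (vec R N)).

Lemma dotC x y : dot x y = dot y x.
Proof. by apply: eq_bigr => i _; rewrite mulrC. Qed.

Lemma dotDl x y z : dot (x + y) z = dot x z + dot y z.
Proof. by rewrite -big_split; apply: eq_bigr => i _; rewrite ffunE mulrDl. Qed.

Lemma dotZl (a : R) x z : dot (a *: x) z = a * dot x z.
Proof.
by rewrite /dot mulr_sumr; apply: eq_bigr => i _; rewrite ffunE mulrA.
Qed.

Lemma dotNl x z : dot (- x) z = - dot x z.
Proof. by rewrite -scaleN1r dotZl mulN1r. Qed.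

Lemma dotBl x y z : dot (x - y) z = dot x z - dot y z.
Proof. by rewrite dotDl dotNl. Qed.

Lemma dotDr x y z : dot z (x + y) = dot z x + dot z y.
Proof. by rewrite dotC dotDl !(dotC z). Qed.

Lemma dotZr (a : R) x z : dot z (a *: x) = a * dot z x.
Proof. by rewrite dotC dotZl dotC. Qed.

Lemma dotBr x y z : dot z (x - y) = dot z x - dot z y.
Proof. by rewrite dotC dotBl !(dotC z). Qed.

Lemma dot_sumZr n (c : 'I_n -> R) (w : 'I_n -> vec R N) z :
  dot z (\sum_i c i *: w i) = \sum_i c i * dot z (w i).
Proof.
elim/big_ind2: _ => [|u a w' b <- <-|i _]; last exact: dotZr.
  by rewrite -(scale0r (0 : vec R N)) dotZr mul0r.
exact: dotDr.
Qed.

Lemma dot_ge0 x : 0 <= dot x x.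
Proof. by apply: sumr_ge0 => i _; rewrite -expr2 sqr_ge0. Qed.

Lemma dot_eq0 x : (dot x x == 0) = (x == 0).
Proof.
apply/eqP/eqP => [x0|->]; last by apply: big1 => i _; rewrite ffunE mul0r.
have sq_ge0 (i : N) : true -> 0 <= x i * x i by rewrite -expr2 sqr_ge0.
apply/ffunP => i; rewrite ffunE; have := psumr_eq0P sq_ge0 x0 (i := i) isT.
by move/eqP; rewrite mulf_eq0 orbb => /eqP.
Qed.

(** By Pythagoras, [|x - y|^2 = |x - p|^2 + |p - y|^2]. *)
Lemma closest_orthogonal K x p :
  K p -> (forall y, K y -> dot (x - p) (p - y) = 0) -> closest K x p.
Proof.
move=> Kp orth; split=> // y Ky neq_yp.
have -> : x - y = (x - p) + (p - y) by rewrite addrA subrK.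
have : p - y != 0 by rewrite subr_eq0 eq_sym.
move: (x - p) (p - y) (orth y Ky) => a b orth_ab nz_b.
have lt_sq : dot a a < dot (a + b) (a + b).
  rewrite dotDl !dotDr (dotC b a) orth_ab addr0 add0r ltrDl.
  by rewrite lt_neqAle dot_ge0 andbT eq_sym dot_eq0.
by rewrite /enorm ltr_sqrt // (le_lt_trans (dot_ge0 _) lt_sq).
Qed.

Lemma closest_unique K x p q : closest K x p -> closest K x q -> q = p.
Proof.
move=> [Kp minp] [Kq minq]; apply/eqP/negPn/negP => neq_qp.
have := lt_trans (minp q Kq neq_qp) (minq p Kp _).
by rewrite ltxx eq_sym => /(_ neq_qp).
Qed.

Lemma proj_closest K x p : closest K x p -> proj K x = p.
Proof.
move=> clp; apply: (closest_unique clp).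
exact: (@xgetPex _ 0 [set q | closest K x q]%classic (ex_intro _ p clp)).
Qed.

End ScalarProduct.

Section Eta.
Variables (R : realType) (N : finType).
Implicit Types (v : {set N} -> R) (x y : vec R N) (S T : {set N}).
Implicit Types (Q : {set {set N}}).

Lemma payoff_dot x S : payoff x S = dot x (indicator R S).
Proof.
rewrite /payoff big_mkcond; apply: eq_bigr => i _.
by rewrite ffunE; case: (i \in S); rewrite ?mulr1 ?mulr0.
Qed.

Lemma dot_eta x S :
  dot x (eta R S) = payoff x S - #|S|%:R / #|N|%:R * payoff x [set: N]%SET.
Proof. by rewrite dotBr dotZr -!payoff_dot. Qed.

Lemma payoff_indicatorT S : payoff (indicator R [set: N]%SET) S = #|S|%:R.
Proof.
rewrite -sumr_const; apply: eq_bigr => i _.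
by rewrite ffunE finset.in_setT.
Qed.

(** The multiple of the all-ones vector subtracted in [eta S] is exactly the one
    that makes the coordinates sum to zero. *)
Lemma payoff_etaT (hN : (0 < #|N|)%N) S :
  payoff (eta R S) [set: N]%SET = 0.
Proof.
rewrite payoff_dot dotC dot_eta !payoff_indicatorT cardsT divfK ?subrr //.
by rewrite pnatr_eq0 -lt0n.
Qed.

(** [eta S] is orthogonal to the all-ones vector, so [eta T] and the indicator
    of [T] have the same scalar product with it. This identifies the effect of
    the direction [eta S] on the payoff of [T] with a Gram entry. *)
Lemma payoff_eta (hN : (0 < #|N|)%N) S T :
  payoff (eta R S) T = dot (eta R T) (eta R S).
Proof. by rewrite [RHS]dotC dot_eta payoff_etaT // mulr0 subr0. Qed.

Lemma payoffD_sum_eta Q x (c : 'I_#|Q| -> R) S :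
  payoff (x + \sum_i c i *: eta R (enum_val i)) S
  = payoff x S + \sum_i c i * payoff (eta R (enum_val i)) S.
Proof.
rewrite !payoff_dot dotDl; congr (_ + _); rewrite dotC dot_sumZr.
by apply: eq_bigr => i _; rewrite payoff_dot dotC.
Qed.

Lemma independent_coef0 Q (c : 'I_#|Q| -> R) :
  independent R Q -> \sum_i c i *: eta R (enum_val i) = 0 -> forall i, c i = 0.
Proof.
move=> indQ sum0; have /freeP := indQ : free (map_tuple (@eta R N) (enum_tuple Q)).
apply; rewrite -[RHS]sum0; apply: eq_bigr => i _; congr (_ *: _).
by rewrite (nth_map finset.set0) -?cardE // -enum_val_nth.
Qed.

(** A row vector [c] with [c *m G = 0] satisfies
    [|\sum_i c_i eta_i|^2 = c *m G *m c^T = 0], so independence forces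
    [c = 0]. *)
Lemma gram_unitmx Q : independent R Q -> gram R Q \in unitmx.
Proof.
move=> indQ; rewrite -row_free_unit -kermx_eq0; apply/rowV0P => c /sub_kermxP cG0.
pose w := \sum_i c ord0 i *: eta R (enum_val i).
have orth (j : 'I_#|Q|) : dot w (eta R (enum_val j)) = 0.
  rewrite dotC dot_sumZr; have /rowP/(_ j) := cG0; rewrite !mxE => cGj0; rewrite -[RHS]cGj0.
  by apply: eq_bigr => i _; rewrite mxE dotC.
have w0 : w = 0.
  apply/eqP; rewrite -dot_eq0 {2}/w dot_sumZr big1 // => i _.
  by rewrite orth mulr0.
by apply/rowP => i; rewrite mxE (independent_coef0 indQ w0).
Qed.

Lemma sum_gamma_gram v Q x (i : 'I_#|Q|) : independent R Q ->
  \sum_(j < #|Q|) gamma v x j * dot (eta R (enum_val i)) (eta R (enum_val j))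
  = excess v (enum_val i) x.
Proof.
move=> indQ; have /colP/(_ i) := mulKVmx (gram_unitmx indQ) (excess_vec v Q x).
rewrite !mxE => <-; apply: eq_bigr => j _.
by rewrite [gram R Q i j]mxE mulrC.
Qed.

Lemma affine_move v Q x (hN : (0 < #|N|)%N) :
  independent R Q -> preimputations v x ->
  affine v Q (x + \sum_(i < #|Q|) gamma v x i *: eta R (enum_val i)).
Proof.
move=> indQ hx; split=> [|S SQ].
  rewrite /preimputations /= payoffD_sum_eta big1 ?addr0 // => i _.
  by rewrite payoff_etaT // mulr0.
rewrite payoffD_sum_eta -(enum_rankK_in SQ SQ).
under eq_bigr do rewrite payoff_eta //.
by rewrite sum_gamma_gram // /excess addrC subrK.
Qed.

Lemma affine_dot_eta v Q x y S :
  affine v Q x -> affine v Q y -> S \in Q -> dot (x - y) (eta R S) = 0.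
Proof.
move=> [xN xQ] [yN yQ] SQ.
by rewrite dotBl !dot_eta xN yN xQ // yQ // subrr.
Qed.

End Eta.

Theorem theorem8 (R : realType) (N : finType) (hN : (0 < #|N|)%N)
    (v : {set N} -> R) (hv : v finset.set0 = 0)
    (Q : {set {set N}}) (hQ : forall S : {set N}, S \in Q -> S != finset.set0)
    (indQ : independent R Q) (x : vec R N) (hx : preimputations v x) :
  proj (affine v Q) x
  = x + \sum_(i < #|Q|) gamma v x i *: eta R (enum_val i).
Proof.
apply: proj_closest; have Ap := affine_move hN indQ hx.
apply: closest_orthogonal => // y Ay; set p := x + _ in Ap *.
have -> : x - p = - \sum_(i < #|Q|) gamma v x i *: eta R (enum_val i).
  by rewrite opprD addNKr.
rewrite dotNl dotC dot_sumZr big1 ?oppr0 // => i _.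
by rewrite (affine_dot_eta Ap Ay (enum_valP i)) mulr0.
Qed.
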